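(* Let $m\in\{1,2,\ldots\}$ and let $\check\rho,\hat\rho>0$ with $\hat\rho=n\check\rho$ for some integer $n\ge 2$. The operator $R:S_{\check\rho}\to S_{\hat\rho}$, $R(M)=B_{\hat\rho/2}(M)\cap\Delta_{\hat\rho}$, satisfies $R(\Delta_{\check\rho})=\Delta_{\hat\rho}$. It has the set-theoretical properties (i) $R(\check M\cup\check M')=R(\check M)\cup R(\check M')$ for all $\check M,\check M'\in S_{\check\rho}$; (ii) $\check M\subset\check M'$ implies $R(\check M)\subset R(\check M')$ for all $\check M,\check M'\in S_{\check\rho}$; (iii) $R(\hat x+\check M)=\hat x+R(\check M)$ for all $\check M\in S_{\check\rho}$ and $\hat x\in\Delta_{\hat\rho}$; the approximation properties (iv) $\mathrm{d}_H(R(\check M),\check M)\le\hat\rho/2$ for all $\check M\in S_{\check\rho}$; (v) $R(\check M)\in A_{\hat\rho}(\check M)$ for all $\check M\in S_{\check\rho}$; (vi) $\hat M\subset R(\check M)$ for all $\check M\in S_{\check\rho}$ and all $\hat M\in A_{\hat\rho}(\check M)$; (vii) $R(\check M)\in V_{\check\rho}^{\hat\rho}(\check M)$ for all $\check M\in S_{\check\rho}$; (viii) $R(\check M)\subset\hat M$ for all $\check M\in S_{\check\rho}$ and all $\hat M\in V_{\check\rho}^{\hat\rho}(\check M)$; and the topology-related properties (ix) $R(\check M)\in C_{\hat\rho}$ for all $\check M\in C_{\check\rho}$; (x) $\partial^0_{\hat\rho}R(\check M)\subset R(\partial^0_{\check\rho}\check M)$ for all $\check M\in S_{\check\rho}$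.
   Context: $\mathbb{R}^m$ carries the maximum norm $\|x\|_\infty=\max_{1\le j\le m}|x_j|$. For nonempty $A,A'\subset\mathbb{R}^m$ let $\mathrm{d}(A,A')=\sup_{x\in A}\inf_{x'\in A'}\|x-x'\|_\infty$ and $\mathrm{d}_H(A,A')=\max\{\mathrm{d}(A,A'),\mathrm{d}(A',A)\}$, with $\mathrm{d}(A,\emptyset)=\infty$ for nonempty $A$; for a point $x$, $\mathrm{d}(x,A)=\mathrm{d}(\{x\},A)$. For $A\subset\mathbb{R}^m$ and $\delta>0$ let $B_\delta(A)=\{x\in\mathbb{R}^m:\mathrm{d}(x,A)\le\delta\}$ (so $B_\delta(\emptyset)=\emptyset$). $M^c$ is the complement in $\mathbb{R}^m$. For $\rho>0$: $\Delta_\rho=\rho\mathbb{Z}^m$ and $S_\rho=\{M\subset\Delta_\rho:M\neq\emptyset\}$. For $M\subset\Delta_\rho$: $\partial^0_\rho M=\{x\in M:\exists z\in M^c\cap\Delta_\rho,\ \|x-z\|_\infty=\rho\}$. Paths: for $x,z\in\Delta_\rho$, $P_\rho(x,z)$ is the set of finite sequences $p=(\xi_0,\ldots,\xi_k)$ in $\Delta_\rho$, $k\in\{0,1,2,\ldots\}$, with $\xi_0=x$, $\xi_k=z$ and $\|\xi_\ell-\xi_{\ell-1}\|_\infty\le\rho$ for $\ell=1,\ldots,k$; $L(p)=k$, $p(\ell)=\xi_\ell$. Connected sets: $C_\rho=\{M\in S_\rho:\forall x,x'\in M\ \exists p\in P_\rho(x,x')\ \text{with}\ p(\ell)\in M\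 \text{for all integers}\ 0\le\ell\le L(p)\}$. For $\rho,\rho'>0$ and $M\in S_\rho$: the best approximations $A_{\rho'}(M)=\operatorname{argmin}\{\mathrm{d}_H(M',M):M'\in S_{\rho'}\}$ (the set of all minimizers $M'\in S_{\rho'}$), and the Voronoi covers $V_\rho^{\rho'}(M)=\{M'\in S_{\rho'}:B_{\rho/2}(M)\subset B_{\rho'/2}(M')\}$. In (x), if $\partial^0_{\check\rho}\check M=\emptyset$, then $R(\emptyset)$ is understood via the same formula, i.e. $R(\emptyset)=\emptyset$. *)

(* Defs.v *)
From HB Require Import structures.
From mathcomp Require Import all_boot all_order all_algebra.
From mathcomp Require Import boolp classical_sets reals ereal topology normedtype.

Set Implicit Arguments.
Unset Strict Implicit.
Unset Printing Implicit Defensive.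

Import Order.TTheory GRing.Theory Num.Theory.
Import numFieldNormedType.Exports.

Local Open Scope classical_set_scope.
Local Open Scope ring_scope.

(** [R^m] is ['rV[R]_m]; its library norm [`|x|] is the maximum norm
    ([mx_normrE]). *)

Section Grids.
Context {R : realType} {m : nat}.
Local Notation V := 'rV[R]_m.
Implicit Types (A M : set V) (x z : V) (rho delta : R).

(** Distances are extended reals: [ereal_inf set0 = +oo] gives
    [semidist A set0 = +oo] for nonempty [A], and distances between unbounded
    sets may be [+oo]. *)
Definition semidist A A' : \bar R :=
  ereal_sup [set ereal_inf [set `|x - x'|%:E | x' in A'] | x in A].

Definition hausdorff_dist A A' : \bar R :=
  Order.max (semidist A A') (semidist A' A).

Definition fattening delta A : set V :=
  [set x | (semidist [set x] A <= delta%:E)%E].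

Definition grid rho : set V :=
  [set rho *: map_mx intr k | k in [set: 'rV[int]_m]].

Definition grid_sets rho : set (set V) :=
  [set M | M `<=` grid rho /\ M !=set0].

Definition grid_boundary rho M : set V :=
  [set x | M x /\ exists z, [/\ (~` M) z, grid rho z & `|x - z| = rho]].

(** A path [(xi_0, ..., xi_k)] is a nonempty list, [p`_l] being [xi_l]. *)
Definition path_length (p : seq V) : nat := (size p).-1.

Definition grid_paths rho x z : set (seq V) :=
  [set p | [/\ (0 < size p)%N,
               (forall l, (l <= path_length p)%N -> grid rho p`_l),
               p`_0 = x,
               p`_(path_length p) = z &
               (forall l, (1 <= l <= path_length p)%N ->
                  `|p`_l - p`_l.-1| <= rho)]].

Definition connected_grid_sets rho : set (set V) :=
  [set M | grid_sets rho M /\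
     forall x x', M x -> M x' ->
       exists2 p, grid_paths rho x x' p &
         forall l, (l <= path_length p)%N -> M p`_l].

Definition best_approximations rho' M : set (set V) :=
  [set M' | grid_sets rho' M' /\
     forall M'', grid_sets rho' M'' ->
       (hausdorff_dist M' M <= hausdorff_dist M'' M)%E].

Definition voronoi_covers rho rho' M : set (set V) :=
  [set M' | grid_sets rho' M' /\
     fattening (rho / 2) M `<=` fattening (rho' / 2) M'].

Definition coarsening rho' M : set V := fattening (rho' / 2) M `&` grid rho'.

Definition translate x A : set V := [set x + y | y in A].

End Grids.

(* Main.v *)
Require Import Defs.
From HB Require Import structures.
From mathcomp Require Import all_boot all_order all_algebra.
From mathcomp Require Import boolp classical_sets reals ereal topology normedtype.
From mathcomp Require Import zify ring lra.
Import Order.TTheory GRing.Theory Num.Theory.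
Import numFieldNormedType.Exports.
Local Open Scope classical_set_scope.
Local Open Scope ring_scope.

(** Write [rho] for the fine and [rho' = n * rho] for the coarse mesh width.
    Every grid is discrete, so the infimum in a distance to a subset of a grid
    is attained whenever it is finite ([fatteningP], [semidist_leP]). Hence
    [y] is in the coarsening [R(M)] iff [y] is a coarse grid point with some
    point of [M] in its closed cell, the ball of radius [rho' / 2] around [y]
    ([coarseningP]); (i)-(iii) are immediate from this.

    The approximation properties rest on two facts. The coarse cells cover the
    space, in the strong form that a fine cell point [x] and its centre [z]
    always share a coarse cell ([cell_overlap]): this gives (iv), with [x = z],
    and (vii). And two coarse grid points at distance less than [rho'] are
    equal ([grid_dist_lt_eq]): for (v), a competitor strictly better than
    [rho' / 2] must be [R(M)] itself ([hausdorff_lt_coarsening]); for (viii),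
    moving a point of [M] slightly towards [y] puts it strictly inside the cell
    of [y], so that only [y] can cover it. Property (vi) follows from the bound
    in (iv).

    For (ix), distances of grid points are multiples of the mesh width. If two
    fine points are adjacent, then coarse centres of cells containing them
    differ by at most [rho' + rho < 2 * rho'], since [n >= 2], hence by at most
    [rho']. Choosing a coarse centre for each point of a fine path therefore
    yields a coarse path.

    For (x), let [y] be in [R(M)] and let its neighbour [y'] be outside. The
    cell of [y] contains a point [x] of [M], the cell of [y'] none, and the two
    cells contain fine grid points [z] and [w] at distance at most [rho]
    ([adjacent_cells_touch]). If [z] is in [M], it is a boundary point because
    of [w]. Otherwise a walk from [x] to [z], which stays inside the cell by
    convexity, leaves [M] at a boundary point ([grid_boundary_in_ball]). *)

Set Implicit Arguments.
Unset Strict Implicit.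

(** * The maximum norm in coordinates *)

Section Norm.
Context {R : realType} {m : nat}.
Implicit Types (x y : 'rV[R]_m) (c : R).

Lemma rV_norm_leP x c : 0 <= c ->
  (`|x| <= c) <-> (forall j, `|x 0 j| <= c).
Proof.
move=> c0; rewrite [`|x|]/Num.Def.normr /= mx_normrE; split.
  by move/bigmax_leP => [_ h] j; exact: (h (0, j)).
by move=> h; apply: bigmax_le => // -[i j] _ /=; rewrite ord1.
Qed.

Lemma rV_normB_leP x y c : 0 <= c ->
  (`|x - y| <= c) <-> (forall j, `|x 0 j - y 0 j| <= c).
Proof.
by move=> c0; rewrite rV_norm_leP//; split=> h j; have := h j; rewrite !mxE.
Qed.

Lemma rV_normB_ge x y j : `|x 0 j - y 0 j| <= `|x - y|.
Proof. by have /rV_normB_leP := lexx `|x - y|; apply. Qed.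

End Norm.

(** * Distances between grid points and attained infima *)

Section GridGeometry.
Context {R : realType} {m : nat}.
Local Notation V := 'rV[R]_m.
Implicit Types (A M : set V) (x y z w : V) (rho c delta : R).

(** Separating the integer coordinates from the matrix encoding of [grid]
    reduces all later arguments to one coordinate. *)
Lemma gridP rho x :
  grid rho x <-> exists k : 'I_m -> int, forall j, x 0 j = rho * (k j)%:~R.
Proof.
split=> [[k _ <-]|[k xk]]; first by exists (k 0) => j; rewrite !mxE.
exists (\row_j k j) => //; apply/rowP => j.
by rewrite !mxE xk.
Qed.

Lemma gridD rho x y : grid rho x -> grid rho y -> grid rho (x + y).
Proof.
move=> /gridP[k xk] /gridP[l yl]; apply/gridP; exists (fun j => k j + l j) => j.
by rewrite mxE xk yl rmorphD /= mulrDr.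
Qed.

Lemma gridN rho x : grid rho x -> grid rho (- x).
Proof.
move=> /gridP[k xk]; apply/gridP; exists (fun j => - k j) => j.
by rewrite mxE xk rmorphN mulrN.
Qed.

Lemma grid_natmul rho n : grid (n%:R * rho) `<=` (grid rho : set V).
Proof.
move=> x /gridP[k xk]; apply/gridP; exists (fun j => n%:Z * k j) => j.
by rewrite xk rmorphM /=; ring.
Qed.

(** The maximum norm of a grid vector is an integer multiple of [rho]. *)
Lemma grid_dist_gap rho x y (i : nat) : 0 < rho -> grid rho x -> grid rho y ->
  `|x - y| < i.+1%:R * rho -> `|x - y| <= i%:R * rho.
Proof.
move=> rho0 /gridP[k xk] /gridP[l yl] lt.
apply/rV_normB_leP => [|j]; first by rewrite mulr_ge0// ltW.
have := le_lt_trans (rV_normB_ge x y j) lt.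
rewrite xk yl -mulrBr -rmorphB /= normrM gtr0_norm// mulrC ltr_pM2r//.
rewrite -intr_norm -[i.+1%:R]/((i.+1%:Z)%:~R) ltr_int => kl.
rewrite ler_pM2r// -[i%:R]/((i%:Z)%:~R) ler_int; lia.
Qed.

Lemma grid_dist_lt_eq rho x y : 0 < rho -> grid rho x -> grid rho y ->
  `|x - y| < rho -> x = y.
Proof.
move=> rho0 gx gy; rewrite -[X in _ < X]mul1r.
move=> /(grid_dist_gap (i := 0) rho0 gx gy).
by rewrite mul0r normr_le0 subr_eq0 => /eqP.
Qed.

Lemma grid_dist_lt2 rho x y : 0 < rho -> grid rho x -> grid rho y ->
  `|x - y| < 2 * rho -> `|x - y| <= rho.
Proof.
by move=> rho0 gx gy /(grid_dist_gap (i := 1) rho0 gx gy); rewrite mul1r.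
Qed.

(** The multiples of [rho] inside [[t - c, t + c]] are those up to a floor, and
    the next multiple on either side lies at a positive distance outside. The
    floor of [(t + c) / rho] handles the right end; reflection in [0] turns the
    left end into the floor of [(c - t) / rho]. *)
Lemma int_dist_gap rho (t c : R) : 0 < rho -> exists2 e, 0 < e &
  forall k : int, `|t - rho * k%:~R| < c + e -> `|t - rho * k%:~R| <= c.
Proof.
move=> rho0.
pose a := (t + c) / rho; pose b := (c - t) / rho.
pose e1 := (Num.floor a + 1)%:~R - a; pose e2 := (Num.floor b + 1)%:~R - b.
have e10 : 0 < e1 by rewrite subr_gt0 floorD1_gt.
have e20 : 0 < e2 by rewrite subr_gt0 floorD1_gt.
exists (rho * Num.min e1 e2); first by rewrite mulr_gt0// lt_min e10.
have aE : t + c = rho * a by rewrite /a mulrC divfK// gt_eqF.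
have bE : c - t = rho * b by rewrite /b mulrC divfK// gt_eqF.
move=> k; rewrite ltr_norml ler_norml => /andP[h1 h2].
have m1 : rho * Num.min e1 e2 <= rho * e1 by rewrite ler_pM2l// ge_min lexx.
have m2 : rho * Num.min e1 e2 <= rho * e2 by rewrite ler_pM2l// ge_min lexx orbT.
have k1 : k%:~R < (Num.floor a + 1)%:~R :> R.
  by rewrite -(ltr_pM2l rho0); move: m1; rewrite /e1 mulrBr; lra.
have k2 : (- k)%:~R < (Num.floor b + 1)%:~R :> R.
  by rewrite -(ltr_pM2l rho0) rmorphN mulrN; move: m2; rewrite /e2 mulrBr; lra.
rewrite ltr_int ltzD1 floor_ge_int in k1.
rewrite ltr_int ltzD1 floor_ge_int rmorphN in k2.
move: k1 k2; rewrite -(ler_pM2l rho0) -aE -(ler_pM2l rho0 _ b) -bE mulrN.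
by move=> k1 k2; apply/andP; split; lra.
Qed.

(** Discreteness of the grid: the smallest of the coordinate gaps works for
    the maximum norm. *)
Lemma grid_point_dist_gap rho x c : 0 < rho -> 0 <= c -> exists2 e, 0 < e &
  forall y, grid rho y -> `|x - y| < c + e -> `|x - y| <= c.
Proof.
move=> rho0 c0.
have /choice[e eP] (j : 'I_m) : exists e, 0 < e /\ forall k : int,
    `|x 0 j - rho * k%:~R| < c + e -> `|x 0 j - rho * k%:~R| <= c.
  by have [e ? ?] := int_dist_gap (x 0 j) c rho0; exists e.
pose e' := \big[Num.min/1]_j e j.
exists e'; first by apply: lt_bigmin => // j _; case: (eP j).
move=> y /gridP[k yk] lt; apply/rV_normB_leP => // j.
rewrite yk; apply: (eP j).2; rewrite -yk.
apply: le_lt_trans (rV_normB_ge x y j) _; apply: lt_le_trans lt _.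
by rewrite lerD2l; apply: bigmin_le_cond.
Qed.

(** An infimum at most [delta] only provides points at distance less than
    [delta + e]; the gap [e] brings them back to distance at most [delta].
    An empty [A] has infimum [+oo], and both sides fail. *)
Lemma ereal_inf_dist_leP rho A x delta : 0 < rho -> 0 <= delta ->
  A `<=` grid rho ->
  (ereal_inf [set `|x - y|%:E | y in A] <= delta%:E)%E <->
  exists2 y, A y & `|x - y| <= delta.
Proof.
move=> rho0 d0 Ag; split=> [le|[y Ay xy]]; last first.
  by apply: ge_ereal_inf; exists `|x - y|%:E; rewrite ?lee_fin//; exists y.
have [e e0 eP] := grid_point_dist_gap x rho0 d0.
have : (ereal_inf [set `|x - y|%:E | y in A] < (delta + e)%:E)%E.
  by apply: le_lt_trans le _; rewrite lte_fin ltrDl.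
move=> /ereal_inf_lt[_ [y Ay <-]]; rewrite lte_fin => lt.
by exists y => //; apply: eP => //; exact: Ag.
Qed.

Lemma fatteningP rho A delta x : 0 < rho -> 0 <= delta -> A `<=` grid rho ->
  fattening delta A x <-> exists2 y, A y & `|x - y| <= delta.
Proof.
move=> rho0 d0 Ag.
rewrite /fattening /= /semidist image_set1 ereal_sup1.
exact: ereal_inf_dist_leP rho0 d0 Ag.
Qed.

Lemma semidist_leP rho A A' delta : 0 < rho -> 0 <= delta -> A' `<=` grid rho ->
  (semidist A A' <= delta%:E)%E <->
  forall x, A x -> exists2 y, A' y & `|x - y| <= delta.
Proof.
move=> rho0 d0 Ag; split=> [le x Ax|h].
  apply/(ereal_inf_dist_leP x rho0 d0 Ag); apply: le_trans le.
  by apply: ereal_sup_ubound; exists x.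
apply: ge_ereal_sup => _ [x Ax <-].
by apply/(ereal_inf_dist_leP x rho0 d0 Ag); exact: h.
Qed.

(** For a strict bound nothing has to be attained, so arbitrary sets are
    allowed. *)
Lemma semidist_lt A A' delta x : (semidist A A' < delta%:E)%E -> A x ->
  exists2 y, A' y & `|x - y| < delta.
Proof.
move=> lt Ax.
have : (ereal_inf [set `|x - y|%:E | y in A'] < delta%:E)%E.
  by apply: le_lt_trans lt; apply: ereal_sup_ubound; exists x.
by move=> /ereal_inf_lt[_ [y Ay <-]]; rewrite lte_fin => xy; exists y.
Qed.

Lemma coarseningP rho rho' M y : 0 < rho -> 0 <= rho' -> M `<=` grid rho ->
  coarsening rho' M y <->
  grid rho' y /\ exists2 x, M x & `|y - x| <= rho' / 2.
Proof.
move=> rho0 r0 Mg; rewrite /coarsening /= /setI /=.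
rewrite (fatteningP _ rho0) ?divr_ge0//.
by split=> -[].
Qed.

End GridGeometry.

(** * Boundary points of grid sets *)

Section Boundary.
Context {R : realType} {m : nat}.
Local Notation V := 'rV[R]_m.
Implicit Types (A M : set V) (x y z w : V) (rho c delta : R).

Lemma grid_boundary_adjacent rho M x z : 0 < rho -> M `<=` grid rho ->
  M x -> grid rho z -> ~ M z -> `|x - z| <= rho -> grid_boundary rho M x.
Proof.
move=> rho0 Mg Mx gz nMz; rewrite le_eqVlt => /orP[/eqP xz|lt].
  by split=> //; exists z.
by case: nMz; rewrite -(grid_dist_lt_eq rho0 (Mg _ Mx) gz lt).
Qed.

(** A walk from [z] in [M] to [w] outside, which moves every coordinate by at
    most one mesh width towards [w], has a last point before it leaves [M] for
    the first time; that point is a boundary point. All coordinates stay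
    between those of [z] and [w], hence the walk stays in the ball around [x].
    The induction is on the number of steps left to [w]. *)
Lemma grid_boundary_in_ball rho M x r z w : 0 < rho -> 0 <= r ->
  M `<=` grid rho -> M z -> grid rho w -> ~ M w ->
  `|x - z| <= r -> `|x - w| <= r ->
  exists2 u, grid_boundary rho M u & `|x - u| <= r.
Proof.
move=> rho0 r0 Mg + gw nMw + cw.
have [l wl] : exists l : 'I_m -> int, forall j, w 0 j = rho * (l j)%:~R.
  exact/gridP.
have [d dz] : exists d : nat, `|z - w| <= d%:R * rho.
  exists (Num.bound (`|z - w| / rho)); rewrite -ler_pdivrMr//.
  by rewrite ltW// archi_boundP// divr_ge0// ltW.
elim: d z dz => [|d IH] z dz Mz cz.
  by case: nMw; move: dz; rewrite mul0r normr_le0 subr_eq0 => /eqP <-.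
have /gridP[k zk] := Mg _ Mz.
pose k' j := k j + sgz (l j - k j).
pose z' : V := \row_j (rho * (k' j)%:~R).
have gz' : grid rho z' by apply/gridP; exists k' => j; rewrite mxE.
have cz' : `|x - z'| <= r.
  apply/rV_normB_leP => // j.
  have := rV_normB_ge x z j; have := rV_normB_ge x w j.
  move=> /le_trans/(_ cw) + /le_trans/(_ cz).
  rewrite zk wl mxE !ler_norml => /andP[w1 w2] /andP[z1 z2].
  have : (k j <= k' j <= l j) || (l j <= k' j <= k j) by rewrite /k'; lia.
  case/orP=> /andP[]; rewrite -(ler_int R) -(ler_pM2l rho0) => a1;
    by rewrite -(ler_int R) -(ler_pM2l rho0) => a2; apply/andP; split; lra.
have zz' : `|z - z'| <= rho.
  apply/rV_normB_leP => [|j]; first exact: ltW.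
  rewrite zk mxE -mulrBr -rmorphB /= normrM gtr0_norm//.
  by rewrite -[leRHS]mulr1 ler_pM2l// -intr_norm -[leRHS]/(1%:~R) ler_int /k'; lia.
(* Either the walk leaves M at this step, or it is continued from z'. *)
have [Mz'|nMz'] := pselect (M z'); last first.
  by exists z => //; exact: grid_boundary_adjacent rho0 Mg Mz gz' nMz' zz'.
apply: (IH z') => //.
apply/rV_normB_leP => [|j]; first by rewrite mulr_ge0// ltW.
have := le_trans (rV_normB_ge z w j) dz.
rewrite mxE zk wl -!mulrBr -!rmorphB /= !normrM !(gtr0_norm rho0).
rewrite ![_ * rho]mulrC !ler_pM2l// -!intr_norm.
rewrite -[d.+1%:R]/((d.+1%:Z)%:~R) -[d%:R]/((d%:Z)%:~R) !ler_int /k'; lia.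
Qed.

End Boundary.

(** * Concatenation of grid paths *)

Section Paths.
Context {R : realType} {m : nat}.
Local Notation V := 'rV[R]_m.
Implicit Types (A M : set V) (x y z w : V) (rho c delta : R).

(** The relation quantified over in [connected_grid_sets], isolated so that
    paths can be built one step at a time without list indices. *)
Definition grid_linked rho A x z :=
  exists2 p, grid_paths rho x z p & forall l, (l <= path_length p)%N -> A p`_l.

Lemma grid_linked_refl rho A x : grid rho x -> A x -> grid_linked rho A x x.
Proof.
by move=> gx Ax; exists [:: x]; [split=> //|]; move=> [|[]].
Qed.

Lemma grid_linked_step rho A x y z : grid_linked rho A x y ->
  grid rho z -> A z -> `|y - z| <= rho -> grid_linked rho A x z.
Proof.
move=> [p [p0 gp px py pstep] Ap] gz Az yz.
have sE l : (rcons p z)`_l = if (l <= path_length p)%N then p`_l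
    else if l == (path_length p).+1 then z else 0.
  by rewrite nth_rcons /path_length -[(l <= _)%N]ltnS prednK.
have LE : path_length (rcons p z) = (path_length p).+1.
  by rewrite /path_length size_rcons prednK.
exists (rcons p z); last first.
  move=> l; rewrite LE sE leq_eqVlt ltnS => /orP[/eqP ->|lp].
    by rewrite ltnn eqxx.
  by rewrite lp; exact: Ap.
split; rewrite ?LE.
- by rewrite size_rcons.
- move=> l; rewrite sE leq_eqVlt ltnS => /orP[/eqP ->|lp].
    by rewrite ltnn eqxx.
  by rewrite lp; exact: gp.
- by rewrite sE.
- by rewrite sE ltnn eqxx.
- move=> l /andP[l0]; rewrite leq_eqVlt ltnS !sE => /orP[/eqP ->|lp] /=.
    by rewrite ltnn eqxx leqnn py distrC.
  by rewrite lp (leq_trans (leq_pred l) lp); apply: pstep; rewrite l0.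
Qed.

End Paths.

(** * Cells of a coarse grid relative to a finer one *)

Section Cells.
Context {R : realType} {m : nat}.
Variables (n : nat) (rho : R).
Hypotheses (n0 : (0 < n)%N) (rho0 : 0 < rho).

Lemma cell_coord_dist (k l : int) :
  (`|rho * k%:~R - n%:R * rho * l%:~R| <= n%:R * rho / 2) =
  (`|k - n%:Z * l| * 2 <= n%:Z).
Proof.
have -> : rho * k%:~R - n%:R * rho * l%:~R = rho * (k - n%:Z * l)%:~R.
  by rewrite rmorphB rmorphM /=; ring.
rewrite normrM gtr0_norm// [n%:R * rho]mulrC -mulrA ler_pM2l//.
by rewrite ler_pdivlMr// -intr_norm -[2]/(2%:~R) -intrM -[n%:R]/((n%:Z)%:~R) ler_int.
Qed.

(** In units of [rho], the walls of the coarse cells lie at integers or at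
    half-integers. A fine cell is therefore cut at most at its centre [k], so
    each of its two halves lies in one coarse cell together with [k]. By
    symmetry it suffices to treat the half to the right of [k]. *)
Lemma cell_coord_overlap (k : int) (t : R) : `|t - rho * k%:~R| <= rho / 2 ->
  exists l : int, `|t - n%:R * rho * l%:~R| <= n%:R * rho / 2 /\
    `|rho * k%:~R - n%:R * rho * l%:~R| <= n%:R * rho / 2.
Proof.
wlog kt : k t / rho * k%:~R <= t.
  move=> H tk; have [le|lt] := lerP (rho * k%:~R) t; first exact: H le tk.
  have [||l [l1 l2]] := H (- k) (- t).
  - by rewrite rmorphN mulrN; lra.
  - by rewrite rmorphN mulrN -opprD normrN.
  exists (- l); rewrite rmorphN !mulrN !opprK.
  move: l1 l2; rewrite rmorphN mulrN -opprD normrN => ->.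
  by rewrite -opprD normrN => ->.
rewrite ger0_norm ?subr_ge0// => tk.
(* This l is the half-open choice: n * l - n / 2 <= k < n * l + n / 2. By
   integrality the strict upper bound leaves room for k + 1 / 2, as h2 states
   after doubling. *)
pose l := ((2 * k + n%:Z) %/ (2 * n%:Z))%Z.
have n20 : 0 < 2 * n%:Z by lia.
have := divz_eq (2 * k + n%:Z) (2 * n%:Z).
have := modz_ge0 (2 * k + n%:Z) (lt0r_neq0 n20).
have := ltz_pmod (2 * k + n%:Z) n20.
rewrite -/l; set q := (_ %% _)%Z => q1 q2 E.
have h1 : - n%:Z <= 2 * (k - n%:Z * l) by lia.
have h2 : 2 * (k - n%:Z * l) + 1 <= n%:Z by lia.
exists l; split; last by rewrite cell_coord_dist; lia.
rewrite -(ler_int R) -(ler_pM2l rho0) in h1.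
rewrite -(ler_int R) -(ler_pM2l rho0) in h2.
move: h1 h2; rewrite !(rmorphM, rmorphB, rmorphD, rmorphN) /=.
rewrite ler_norml => h1 h2; apply/andP; split; lra.
Qed.

Lemma cell_overlap (x z : 'rV[R]_m) : grid rho z -> `|x - z| <= rho / 2 ->
  exists y, [/\ grid (n%:R * rho) y, `|x - y| <= n%:R * rho / 2 &
    `|z - y| <= n%:R * rho / 2].
Proof.
have nr0 : 0 <= n%:R * rho / 2 by rewrite divr_ge0// mulr_ge0// ltW.
move=> /gridP[k zk] xz.
have /choice[l lP] j : exists l : int,
   `|x 0 j - n%:R * rho * l%:~R| <= n%:R * rho / 2 /\
   `|z 0 j - n%:R * rho * l%:~R| <= n%:R * rho / 2.
  rewrite zk; apply: cell_coord_overlap; rewrite -zk.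
  exact: le_trans (rV_normB_ge x z j) xz.
exists (\row_j (n%:R * rho * (l j)%:~R)); split.
- by apply/gridP; exists l => j; rewrite mxE.
- by apply/rV_normB_leP => // j; rewrite mxE; case: (lP j).
- by apply/rV_normB_leP => // j; rewrite mxE; case: (lP j).
Qed.

(** In units of [rho], walk from the centre [y] towards [y']: after
    [floor (n / 2)] steps the fine grid point [z] is still in the cell of [y],
    and with [floor (n / 2)] steps left the point [w] is in the cell of [y'].
    These points coincide for even [n] and are adjacent for odd [n]. *)
Lemma adjacent_cells_touch (y y' : 'rV[R]_m) :
  grid (n%:R * rho) y -> grid (n%:R * rho) y' -> `|y - y'| <= n%:R * rho ->
  exists z w, [/\ grid rho z, grid rho w, `|y - z| <= n%:R * rho / 2,
    `|y' - w| <= n%:R * rho / 2 & `|z - w| <= rho].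
Proof.
have nr0 : 0 < n%:R * rho by rewrite mulr_gt0// ltr0n.
have nr20 : 0 <= n%:R * rho / 2 by rewrite divr_ge0// ltW.
move=> /gridP[l yl] /gridP[l' yl'] yy'.
have ll' j : `|l j - l' j| <= 1.
  have := le_trans (rV_normB_ge y y' j) yy'.
  rewrite yl yl' -mulrBr -rmorphB /= normrM gtr0_norm//.
  by rewrite -[leRHS]mulr1 ler_pM2l// -intr_norm -[leRHS]/(1%:~R) ler_int.
pose d j := l' j - l j.
pose h : int := (n %/ 2)%N.
exists (\row_j (rho * (n%:Z * l j + d j * h)%:~R)).
exists (\row_j (rho * (n%:Z * l j + d j * (n%:Z - h))%:~R)).
have dE j : [\/ d j = 0, d j = 1 | d j = -1].
  have := ll' j; rewrite /d => ?.
  have : [|| l' j - l j == 0, l' j - l j == 1 | l' j - l j == -1] by lia.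
  by case/or3P=> /eqP ->; [constructor 1|constructor 2|constructor 3].
split.
- by apply/gridP; eexists=> j; rewrite mxE.
- by apply/gridP; eexists=> j; rewrite mxE.
- apply/rV_normB_leP => // j; rewrite mxE yl distrC cell_coord_dist.
  by case: (dE j) => ->; rewrite /h; lia.
- apply/rV_normB_leP => // j; rewrite mxE yl' distrC cell_coord_dist.
  have -> : l' j = l j + d j by rewrite /d; lia.
  by case: (dE j) => ->; rewrite /h; lia.
- apply/rV_normB_leP => [|j]; first exact: ltW.
  rewrite !mxE -mulrBr -rmorphB /= normrM gtr0_norm//.
  rewrite -[leRHS]mulr1 ler_pM2l// -intr_norm -[leRHS]/(1%:~R) ler_int.
  by case: (dE j) => ->; rewrite /h; lia.
Qed.

End Cells.
(** * Properties of the coarsening operator *)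

Section Coarsening.
Context {R : realType} {m : nat}.
Local Notation V := 'rV[R]_m.
Variables (n : nat) (rho : R).
Hypotheses (n1 : (1 < n)%N) (rho0 : 0 < rho).
Local Notation rho' := (n%:R * rho).
Implicit Types (M : set V) (x y z : V).

Let n0 : (0 < n)%N := ltnW n1.
Let rho'0 : 0 < rho'. Proof. by rewrite mulr_gt0// ltr0n. Qed.
Let half0 : 0 <= rho' / 2. Proof. by rewrite divr_ge0// ltW. Qed.

Let coarsenP M y : M `<=` grid rho ->
  coarsening rho' M y <->
  grid rho' y /\ exists2 x, M x & `|y - x| <= rho' / 2.
Proof. by move=> Mg; apply: coarseningP Mg => //; exact: ltW. Qed.

Let coarsening_grid M : coarsening rho' M `<=` grid rho'.
Proof. by move=> y []. Qed.

(** The cells of the coarse grid cover the fine grid. *)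
Lemma near_coarsening M x : M `<=` grid rho -> M x ->
  exists2 y, coarsening rho' M y & `|x - y| <= rho' / 2.
Proof.
move=> Mg Mx.
have [|y [gy _ xy]] := cell_overlap n0 rho0 (x := x) (Mg _ Mx).
  by rewrite subrr normr0 divr_ge0// ltW.
by exists y => //; apply/coarsenP => //; split=> //; exists x => //; rewrite distrC.
Qed.

Lemma coarsening_grid_sets M : grid_sets rho M -> grid_sets rho' (coarsening rho' M).
Proof.
move=> [Mg [x Mx]]; split=> //.
by have [y ? _] := near_coarsening Mg Mx; exists y.
Qed.

Lemma coarsening_full : coarsening rho' (grid rho : set V) = grid rho'.
Proof.
apply/seteqP; split=> // y gy; apply/coarsenP => //; split=> //.
by exists y; [exact: grid_natmul gy|rewrite subrr normr0].
Qed.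

Lemma coarseningS M M' : M' `<=` grid rho -> M `<=` M' ->
  coarsening rho' M `<=` coarsening rho' M'.
Proof.
move=> Mg MM' y /coarsenP[|gy [x Mx yx]]; first exact: subset_trans Mg.
by apply/coarsenP => //; split=> //; exists x => //; exact: MM'.
Qed.

Lemma coarseningU M M' : M `<=` grid rho -> M' `<=` grid rho ->
  coarsening rho' (M `|` M') = coarsening rho' M `|` coarsening rho' M'.
Proof.
move=> Mg M'g; have Ug : M `|` M' `<=` grid rho by rewrite subUset.
apply/seteqP; split; last first.
  by rewrite subUset; split; apply: coarseningS.
move=> y /coarsenP[//|gy [x [Mx|Mx] yx]]; [left|right];
  by apply/coarsenP => //; split=> //; exists x.
Qed.

Lemma coarsening_translate M x : M `<=` grid rho -> grid rho' x ->
  coarsening rho' (translate x M) = translate x (coarsening rho' M).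
Proof.
move=> Mg gx.
have Tg : translate x M `<=` grid rho.
  by move=> _ [z Mz <-]; apply: gridD; [exact: grid_natmul gx|exact: Mg].
apply/seteqP; split=> [y /coarsenP[//|gy [_ [z Mz <-] yz]]|_ [y + <-]].
  exists (y - x); last by rewrite addrC subrK.
  apply/coarsenP => //; split; first by apply: gridD => //; exact: gridN.
  by exists z => //; rewrite -addrA -opprD.
move=> /coarsenP[//|gy [z Mz yz]]; apply/coarsenP => //.
split; first exact: gridD.
by exists (x + z); [exists z|rewrite opprD addrACA subrr add0r].
Qed.

Lemma coarsening_hausdorff M : M `<=` grid rho ->
  (hausdorff_dist (coarsening rho' M) M <= (rho' / 2)%:E)%E.
Proof.
move=> Mg; rewrite /hausdorff_dist ge_max; apply/andP; split.
  apply/(semidist_leP _ rho0 half0 Mg) => y.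
  by move=> /coarsenP[].
by apply/(semidist_leP _ rho'0 half0) => // x Mx; exact: near_coarsening.
Qed.

(** If [N] and [M] are closer than [rho' / 2], every point of [N] has a point
    of [M] in its cell. Conversely, if [y] has [x] of [M] in its cell, some
    point of [N] is closer to [x] than [rho' / 2], hence closer to [y] than
    [rho'], and must be [y]. *)
Lemma hausdorff_lt_coarsening M N : M `<=` grid rho -> N `<=` grid rho' ->
  (hausdorff_dist N M < (rho' / 2)%:E)%E -> N = coarsening rho' M.
Proof.
move=> Mg Ng; rewrite /hausdorff_dist gt_max => /andP[NM MN].
apply/seteqP; split=> y.
  move=> Ny; apply/coarsenP => //; split; first exact: Ng.
  by have [x Mx /ltW] := semidist_lt NM Ny; exists x.
move=> /coarsenP[//|gy [x Mx yx]].
have [y' Ny' xy'] := semidist_lt MN Mx.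
suff -> : y = y' by [].
apply: (grid_dist_lt_eq rho'0 gy (Ng _ Ny')).
by have := ler_distD x y y'; lra.
Qed.

(** Hausdorff distances of at least [rho' / 2] are not better than that of the
    coarsening, and smaller ones are realized by the coarsening only. *)
Lemma coarsening_best M : grid_sets rho M ->
  best_approximations rho' M (coarsening rho' M).
Proof.
move=> SM; split=> [|N [Ng _]]; first exact: coarsening_grid_sets.
have [ge|lt] := leP (rho' / 2)%:E (hausdorff_dist N M).
  exact: le_trans (coarsening_hausdorff SM.1) ge.
by rewrite (hausdorff_lt_coarsening SM.1 Ng lt).
Qed.

Lemma best_sub_coarsening M N : grid_sets rho M ->
  best_approximations rho' M N -> N `<=` coarsening rho' M.
Proof.
move=> SM [[Ng _] Nbest] y Ny; apply/coarsenP; first exact: SM.1.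
split; first exact: Ng.
have le : (hausdorff_dist N M <= (rho' / 2)%:E)%E.
  apply: le_trans (coarsening_hausdorff SM.1).
  by apply: Nbest; exact: coarsening_grid_sets.
move: le; rewrite /hausdorff_dist ge_max => /andP[+ _].
by move/(semidist_leP _ rho0 half0 SM.1); apply.
Qed.

Lemma coarsening_voronoi M : grid_sets rho M ->
  voronoi_covers rho rho' M (coarsening rho' M).
Proof.
move=> SM; split=> [|x]; first exact: coarsening_grid_sets.
have rho20 : 0 <= rho / 2 by rewrite divr_ge0// ltW.
move=> /(fatteningP x rho0 rho20 SM.1)[z Mz xz].
apply/(fatteningP x rho'0 half0) => //.
have [y [gy xy zy]] := cell_overlap n0 rho0 (SM.1 _ Mz) xz.
exists y => //; apply/coarsenP; first exact: SM.1.
by split=> //; exists z => //; rewrite distrC.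
Qed.

Lemma coarsening_sub_voronoi M N : grid_sets rho M ->
  voronoi_covers rho rho' M N -> coarsening rho' M `<=` N.
Proof.
move=> SM [[Ng _] MN] y /(coarsenP _ SM.1)[gy [z Mz yz]].
have rho20 : 0 <= rho / 2 by rewrite divr_ge0// ltW.
have nR0 : 0 < n%:R :> R by rewrite ltr0n.
(* The fraction 1 / n of the way from z to y has length at most rho / 2, so x
   stays in the fine cell of z, while x is strictly inside the cell of y. *)
pose x := z + n%:R^-1 *: (y - z).
have xz : `|x - z| <= rho / 2.
  rewrite /x addrAC subrr add0r normrZ gtr0_norm ?invr_gt0//.
  by rewrite ler_pdivrMl// mulrA.
have yx : `|y - x| < rho' / 2.
  have -> : y - x = (1 - n%:R^-1) *: (y - z) by rewrite /x scalerBl scale1r opprD addrA.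
  have i1 : n%:R^-1 < 1 :> R by rewrite invf_lt1// ltr1n.
  have i0 : 0 < n%:R^-1 :> R by rewrite invr_gt0.
  rewrite normrZ gtr0_norm ?subr_gt0//.
  have h : 0 < rho' / 2 by rewrite divr_gt0.
  have : (1 - n%:R^-1) * `|y - z| <= (1 - n%:R^-1) * (rho' / 2).
    by rewrite ler_pM2l// subr_gt0.
  by move/le_lt_trans; apply; rewrite gtr_pMl// ltrBlDr ltrDl.
have /MN : fattening (rho / 2) M x.
  by apply/(fatteningP x rho0 rho20 SM.1); exists z.
move=> /(fatteningP x rho'0 half0 Ng)[y' Ny' xy'].
suff -> : y = y' by [].
apply: (grid_dist_lt_eq rho'0 gy (Ng _ Ny')).
by have := ler_distD x y y'; lra.
Qed.

Lemma coarsening_connected M : connected_grid_sets rho M ->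
  connected_grid_sets rho' (coarsening rho' M).
Proof.
move=> [SM conn]; split; first exact: coarsening_grid_sets.
have Mg := SM.1.
move=> y y' Ry Ry'.
have [gy [x Mx yx]] := (coarsenP y Mg).1 Ry.
have [gy' [x' Mx' yx']] := (coarsenP y' Mg).1 Ry'.
have [p [_ _ px px' pstep] Mp] := conn _ _ Mx Mx'.
(* The claim is about every coarse u near p`_l, not about a chosen one, so that
   the last step can end in the prescribed point y'. *)
suff H l u : (l <= path_length p)%N -> grid rho' u ->
    `|u - p`_l| <= rho' / 2 -> grid_linked rho' (coarsening rho' M) y u.
  by apply: (H (path_length p)) => //; rewrite px'.
elim: l u => [|l IH] u lp gu up.
  have Ru : coarsening rho' M u.
    by apply/coarsenP => //; split=> //; exists p`_0 => //; exact: Mp.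
  apply: (grid_linked_step (grid_linked_refl gy Ry)) => //.
  move: up; rewrite px => up; have := ler_distD x y u.
  by rewrite [`|x - u|]distrC; lra.
have Ru : coarsening rho' M u.
  by apply/coarsenP => //; split=> //; exists p`_l.+1 => //; exact: Mp.
have [v Rv pv] := near_coarsening Mg (Mp l (ltnW lp)).
have gv := coarsening_grid Rv.
apply: (grid_linked_step (IH v (ltnW lp) gv _)) => //; first by rewrite distrC.
(* The triangle inequality gives rho' + rho, and rho < rho' as 1 < n. *)
apply: grid_dist_lt2 => //.
have vu := ler_distD p`_l v u; have pu := ler_distD p`_l.+1 p`_l u.
have := pstep l.+1 lp; rewrite /= distrC => pp.
have rho2 : 2 * rho <= rho' by rewrite ler_pM2r// ler_nat.
move: rho'0 vu pu up pv.
by rewrite [`|p`_l - v|]distrC [`|u - p`_l.+1|]distrC; lra.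
Qed.

Lemma coarsening_boundary M : M `<=` grid rho ->
  grid_boundary rho' (coarsening rho' M)
    `<=` coarsening rho' (grid_boundary rho M).
Proof.
move=> Mg y [/(coarsenP _ Mg)[gy [x Mx yx]] [y' [nRy' gy' yy']]].
have [|z [w [gz gw yz y'w zw]]] := adjacent_cells_touch n0 rho0 gy gy'.
  by rewrite yy'.
have nMw : ~ M w.
  by move=> Mw; apply: nRy'; apply/coarsenP => //; split=> //; exists w.
apply/coarsenP; first by move=> ? [/Mg].
split=> //.
have [Mz|nMz] := pselect (M z).
  by exists z => //; exact: grid_boundary_adjacent Mz gw nMw zw.
exact: grid_boundary_in_ball Mx gz nMz yx yz.
Qed.

End Coarsening.

Unset Implicit Arguments.
Set Strict Implicit.

Theorem theorem21 (R : realType) (m n : nat) (rhoc rhoh : R)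
    (hm : (1 <= m)%N) (hn : (2 <= n)%N)
    (hrhoc : 0 < rhoc) (hrhoh : 0 < rhoh) (hrho : rhoh = n%:R * rhoc) :
  (* R : S_rhoc -> S_rhoh, and R (Delta_rhoc) = Delta_rhoh *)
  (forall M : set 'rV[R]_m, grid_sets rhoc M ->
     grid_sets rhoh (coarsening rhoh M)) /\
  coarsening rhoh (grid rhoc : set 'rV[R]_m) = grid rhoh /\
  (* (i) *)
  (forall M M' : set 'rV[R]_m, grid_sets rhoc M -> grid_sets rhoc M' ->
     coarsening rhoh (M `|` M') = coarsening rhoh M `|` coarsening rhoh M') /\
  (* (ii) *)
  (forall M M' : set 'rV[R]_m, grid_sets rhoc M -> grid_sets rhoc M' ->
     M `<=` M' -> coarsening rhoh M `<=` coarsening rhoh M') /\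
  (* (iii) *)
  (forall (M : set 'rV[R]_m) (x : 'rV[R]_m), grid_sets rhoc M -> grid rhoh x ->
     coarsening rhoh (translate x M) = translate x (coarsening rhoh M)) /\
  (* (iv) *)
  (forall M : set 'rV[R]_m, grid_sets rhoc M ->
     (hausdorff_dist (coarsening rhoh M) M <= (rhoh / 2)%:E)%E) /\
  (* (v) *)
  (forall M : set 'rV[R]_m, grid_sets rhoc M ->
     best_approximations rhoh M (coarsening rhoh M)) /\
  (* (vi) *)
  (forall M Mh : set 'rV[R]_m, grid_sets rhoc M ->
     best_approximations rhoh M Mh -> Mh `<=` coarsening rhoh M) /\
  (* (vii) *)
  (forall M : set 'rV[R]_m, grid_sets rhoc M ->
     voronoi_covers rhoc rhoh M (coarsening rhoh M)) /\
  (* (viii) *)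
  (forall M Mh : set 'rV[R]_m, grid_sets rhoc M ->
     voronoi_covers rhoc rhoh M Mh -> coarsening rhoh M `<=` Mh) /\
  (* (ix) *)
  (forall M : set 'rV[R]_m, connected_grid_sets rhoc M ->
     connected_grid_sets rhoh (coarsening rhoh M)) /\
  (* (x) *)
  (forall M : set 'rV[R]_m, grid_sets rhoc M ->
     grid_boundary rhoh (coarsening rhoh M)
       `<=` coarsening rhoh (grid_boundary rhoc M)).
Proof.
rewrite hrho.
split; first by move=> M; exact: coarsening_grid_sets.
split; first exact: coarsening_full.
split; first by move=> M M' [Mg _] [M'g _]; exact: coarseningU.
split; first by move=> M M' _ [M'g _]; exact: coarseningS.
split; first by move=> M x [Mg _]; exact: coarsening_translate.
split; first by move=> M [Mg _]; exact: coarsening_hausdorff.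
split; first by move=> M; exact: coarsening_best.
split; first by move=> M N; exact: best_sub_coarsening.
split; first by move=> M; exact: coarsening_voronoi.
split; first by move=> M N; exact: coarsening_sub_voronoi.
split; first by move=> M; exact: coarsening_connected.
by move=> M [Mg _]; exact: coarsening_boundary.
Qed.
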